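(* Let $B$ be a bialgebra over a field $k$ and let $\mathcal{R}$ be an idempotent radical class of $\mathbf{Coalg}\text{-}B$. Then every right $B$-module coalgebra $C$ contains a unique maximal $B$-submodule coalgebra belonging to $\mathcal{R}$.
   Context: All algebras and coalgebras are over a field $k$ and $\otimes=\otimes_k$. A (right) $B$-module coalgebra is a coalgebra $C$ which is a right $B$-module such that $\Delta:C\to C\otimes C$ and $\varepsilon:C\to k$ are $B$-module maps ($C\otimes C$ with the diagonal $B$-action, $k$ the trivial module). $\mathbf{Coalg}\text{-}B$ is the category of right $B$-module coalgebras. A $B$-submodule coalgebra of $C$ is a subcoalgebra invariant under the $B$-action. For subspaces $X,Y\subseteq C$, $X\wedge Y=\Delta^{-1}(X\otimes C+C\otimes Y)$. For a collection $\mathcal{R}$ of $B$-module coalgebras, a member of $\mathcal{R}$ is called an $\mathcal{R}$-coalgebra, and a $B$-submodule coalgebra of $C$ which is a member of $\mathcal{R}$ is called an $\mathcal{R}$-subcoalgebra of $C$. A non-empty collection $\mathcal{R}$ of objects of $\mathbf{Coalg}\text{-}B$ is a radical class if: (R1) every $B$-submodule coalgebra of an $\mathcal{R}$-coalgebra is an $\mathcal{R}$-coalgebra; (R2) for any $C\in\mathbf{Coalg}\text{-}B$ and any family $\{C_i\}_{i\in I}$ of $\mathcal{R}$-subcoalgebras of $C$, $\sum_{i\in I}C_i\in\mathcal{R}$. It is idempotent if moreover: (R3) for any $C\in\mathbf{Coalg}\text{-}B$ and any $\mathcal{R}$-subcoalgebras $C_1,C_2$ of $C$, $C_1\wedge C_2\in\mathcal{R}$.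 ''Maximal'' is with respect to inclusion. *)

(* Defs.v *)
From HB Require Import structures.
From mathcomp Require Import all_boot all_order all_algebra.
From mathcomp Require Import ring_quotient.
From mathcomp.classical Require Import boolp classical_sets.
From mathcomp.multinomials Require Import freeg.

Set Implicit Arguments.
Unset Strict Implicit.
Unset Printing Implicit Defensive.

Import GRing.Theory.
Local Open Scope ring_scope.
Local Open Scope classical_set_scope.

Reserved Notation "x \ox y" (at level 40, left associativity).

Section Subspaces.
Context {k : fieldType} {V : lmodType k}.

Definition subspace (X : set V) : Prop :=
  X 0 /\ forall (a : k) x y, X x -> X y -> X (a *: x + y).

Lemma subspaceD X x y : subspace X -> X x -> X y -> X (x + y).
Proof. by move=> [_ h] Xx Xy; rewrite -[x]scale1r; exact: h. Qed.

Lemma subspaceZ X a x : subspace X -> X x -> X (a *: x).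
Proof. by move=> [h0 h] Xx; rewrite -[_ *: _]addr0; exact: h. Qed.

Lemma subspace_sum X (I : eqType) (s : seq I) (F : I -> V) : subspace X ->
  (forall i, i \in s -> X (F i)) -> X (\sum_(i <- s) F i).
Proof.
move=> hX hF; rewrite big_seq; elim/big_ind: _ => //; first by case: hX.
by move=> x y; exact: subspaceD.
Qed.

Lemma subspace_submod_closed X :
  subspace X -> GRing.submod_closed (fun x => x \in X).
Proof.
move=> [h0 h]; split; first by rewrite inE.
by move=> a x y; rewrite !inE; exact: h.
Qed.

End Subspaces.

Section TensorDef.
Context {k : fieldType} (V W : lmodType k).

Local Notation free := {freeg (V * W)%type / k}.

Definition bilinear_relator (z : free) : Prop :=
  (exists a v v' w,
     z = << (a *: v + v', w) >> - (<< a *g (v, w) >> + << (v', w) >>)) \/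
  (exists a v w w',
     z = << (v, a *: w + w') >> - (<< a *g (v, w) >> + << (v, w') >>)).

(* The subspace spanned by the bilinearity relators. *)
Definition tensor_relations : {pred free} :=
  fun z => `[< forall S : set free,
                 subspace S -> bilinear_relator `<=` S -> S z >].

Lemma tensor_relations_subspace : subspace [set z | z \in tensor_relations].
Proof.
split=> [|a x y] /=; first by apply/asboolP => S [].
move=> /asboolP hx /asboolP hy; apply/asboolP => S hS hr.
by apply: hS.2; [exact: hx|exact: hy].
Qed.

Lemma tensor_relations_closed : GRing.submod_closed tensor_relations.
Proof. by case: tensor_relations_subspace => h0 h; split. Qed.

HB.instance Definition _ :=
  GRing.isSubmodClosed.Build k free tensor_relations tensor_relations_closed.

Definition tensor : Type := Quotient.quot tensor_relations.

HB.instance Definition _ := GRing.Zmodule.on tensor.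

Local Notation pi := (\pi_(Quotient.quot tensor_relations)%qT : free -> tensor).

Lemma tensor_piP x y : (pi x = pi y) <-> (x - y \in tensor_relations).
Proof. by rewrite Quotient.idealrBE; split => [->|/eqP]. Qed.

Lemma tensor_reprK (t : tensor) : pi (repr t) = t.
Proof. exact: reprK. Qed.

Definition tensor_scale (a : k) (t : tensor) : tensor := pi (a *: repr t).

Lemma tensor_scale_pi a x : tensor_scale a (pi x) = pi (a *: x).
Proof.
apply/tensor_piP; rewrite -scalerBr; apply: rpredZ.
by apply/tensor_piP; rewrite tensor_reprK.
Qed.

Fact tensor_scaleA a b t :
  tensor_scale a (tensor_scale b t) = tensor_scale (a * b) t.
Proof. by rewrite -[t]tensor_reprK !tensor_scale_pi scalerA. Qed.

Fact tensor_scale1 : left_id 1 tensor_scale.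
Proof. by move=> t; rewrite -[t]tensor_reprK !tensor_scale_pi scale1r. Qed.

Fact tensor_scaleDr : right_distributive tensor_scale +%R.
Proof.
move=> a s t; rewrite -[s]tensor_reprK -[t]tensor_reprK.
by rewrite -raddfD !tensor_scale_pi -raddfD scalerDr.
Qed.

Fact tensor_scaleDl t : {morph tensor_scale^~ t : a b / a + b}.
Proof.
move=> a b; rewrite -[t]tensor_reprK.
by rewrite !tensor_scale_pi -raddfD scalerDl.
Qed.

HB.instance Definition _ := GRing.Zmodule_isLmodule.Build k tensor
  tensor_scaleA tensor_scale1 tensor_scaleDr tensor_scaleDl.

Lemma tensor_scale_piE a x : a *: pi x = pi (a *: x).
Proof. exact: tensor_scale_pi. Qed.

Definition tens (v : V) (w : W) : tensor := pi << (v, w) >>.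

End TensorDef.

Notation "V \ox W" := (tensor V%type W%type) : type_scope.
Notation "v \ox w" := (tens v w) : ring_scope.

Definition bilinear_map {k : fieldType} {V W U : lmodType k} (f : V -> W -> U) :=
  (forall w, linear (f^~ w)) /\ (forall v, linear (f v)).

Section TensorTheory.
Context {k : fieldType}.
Implicit Types V W U : lmodType k.

Section Universal.
Context {V W U : lmodType k}.

Local Notation free := {freeg (V * W)%type / k}.
Local Notation pi :=
  (\pi_(Quotient.quot (@tensor_relations k V W))%qT : free -> V \ox W).

Lemma tens_bilinear : bilinear_map (@tens k V W).
Proof.
split=> [w a v v'|v a w w']; rewrite /tens tensor_scale_piE -raddfD;
  apply/tensor_piP/asboolP => S hS; apply.
- left; exists a, v, v', w; congr (_ - (_ + _)).
  by apply/eqP/freeg_eqP => x; rewrite coeffZ !coeffU mul1r.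
- right; exists a, v, w, w'; congr (_ - (_ + _)).
  by apply/eqP/freeg_eqP => x; rewrite coeffZ !coeffU mul1r.
Qed.

(* The linear map induced by a bilinear map [f]; the value is meaningless when
   [f] is not bilinear, as it then depends on the representative of [t]. *)
Definition tlift (f : V -> W -> U) (t : V \ox W) : U :=
  fglift (fun p : V * W => f p.1 p.2) (repr t).

Lemma fglift_linear (f : V * W -> U) : linear (fglift f : free -> U).
Proof.
have add : {morph (fglift f : free -> U) : x y / x + y}.
  move=> x y; have /= h := @lift_is_additive _ _ _ f.
  have h0 : fglift f 0 = 0 by have := h 0 0; rewrite !subrr.
  have hN z : fglift f (- z) = - fglift f z by have := h 0 z; rewrite h0 !sub0r.
  by rewrite -[y in LHS]opprK h hN opprK.
have add0 : fglift f 0 = 0.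
  by apply: (addrI (fglift f 0)); rewrite -add !addr0.
have scale a (x : free) : fglift f (a *: x) = a *: fglift f x.
  rewrite -[x]freeg_sumE scaler_sumr !(big_morph _ add add0) scaler_sumr.
  apply: eq_bigr => z _.
  have -> : a *: << coeff z x *g z >> = << a * coeff z x *g z >> :> free.
    by apply/eqP/freeg_eqP => y; rewrite coeffZ !coeffU mulrA.
  by rewrite !liftU scalerA.
by move=> a x y; rewrite add scale.
Qed.

Lemma bilinear_uncurry (f : V -> W -> U) : bilinear_map f ->
  forall z : free, z \in @tensor_relations k V W ->
    fglift (fun p : V * W => f p.1 p.2) z = 0.
Proof.
move=> [fl fr] z /asboolP hz; set F := fglift _.
have Flin : linear F := @fglift_linear _.
have F0 : F 0 = 0.
  by have := Flin (-1) 0 0; rewrite scaler0 addr0 scaleN1r addNr.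
have FD x y : F (x + y) = F x + F y by have := Flin 1 x y; rewrite !scale1r.
have FN x : F (- x) = - F x.
  by have := Flin (-1) x 0; rewrite F0 !addr0 !scaleN1r.
apply: (hz [set z | F z = 0]).
  by split=> //= a x y; rewrite Flin => -> ->; rewrite scaler0 addr0.
move=> _ [[a [v [v' [w ->]]]]|[a [v [w [w' ->]]]]] /=;
  rewrite FD FN FD /F !liftU /= !scale1r.
  by rewrite fl subrr.
by rewrite fr subrr.
Qed.

Lemma tlift_pi (f : V -> W -> U) (z : free) : bilinear_map f ->
  tlift f (pi z) = fglift (fun p : V * W => f p.1 p.2) z.
Proof.
move=> hf; rewrite /tlift; apply/eqP; rewrite -subr_eq0 -scaleN1r addrC.
rewrite -fglift_linear scaleN1r addrC; apply/eqP/bilinear_uncurry => //.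
by apply/tensor_piP; rewrite tensor_reprK.
Qed.

Lemma tlift_linear (f : V -> W -> U) : bilinear_map f -> linear (tlift f).
Proof.
move=> hf a s t; rewrite -[s]tensor_reprK -[t]tensor_reprK.
by rewrite tensor_scale_piE -raddfD !tlift_pi // fglift_linear.
Qed.

Lemma tlift_tens (f : V -> W -> U) v w :
  bilinear_map f -> tlift f (v \ox w) = f v w.
Proof. by move=> hf; rewrite tlift_pi // liftU scale1r. Qed.

Lemma tensor_ind (P : V \ox W -> Prop) : P 0 ->
  (forall a v w t, P t -> P (a *: (v \ox w) + t)) -> forall t, P t.
Proof.
move=> P0 PD t; rewrite -[t]tensor_reprK -[repr t]freeg_sumE raddf_sum /=.
elim: (dom _) => [|z s IH]; first by rewrite big_nil.
rewrite big_cons; set c := coeff z _; case: z @c => v w c.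
have -> : << c *g (v, w) >> = c *: << (v, w) >> :> free.
  by apply/eqP/freeg_eqP => y; rewrite coeffZ !coeffU mul1r.
by rewrite -tensor_scale_piE; apply: PD.
Qed.

Lemma tensor_ext (f g : V \ox W -> U) : linear f -> linear g ->
  (forall v w, f (v \ox w) = g (v \ox w)) -> forall t, f t = g t.
Proof.
have lin0 (h : V \ox W -> U) : linear h -> h 0 = 0.
  by move=> hh; have := hh (-1) 0 0; rewrite scaler0 addr0 scaleN1r addNr.
move=> hf hg e; apply: tensor_ind; first by rewrite !lin0.
by move=> a v w t IH; rewrite hf hg e IH.
Qed.

End Universal.

Section Linear.
Context {V W U : lmodType k}.

Lemma linear_fun0 (f : V -> W) : linear f -> f 0 = 0.
Proof.
by move=> hf; have := hf (-1) 0 0; rewrite scaler0 addr0 scaleN1r addNr.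
Qed.

Lemma linear_funD (f : V -> W) x y : linear f -> f (x + y) = f x + f y.
Proof. by move=> hf; have := hf 1 x y; rewrite !scale1r. Qed.

Lemma linear_funZ (f : V -> W) a x : linear f -> f (a *: x) = a *: f x.
Proof.
by move=> hf; have := hf a x 0; rewrite linear_fun0 // !addr0.
Qed.

Lemma linear_funN (f : V -> W) x : linear f -> f (- x) = - f x.
Proof. by move=> hf; rewrite -scaleN1r linear_funZ // scaleN1r. Qed.

Lemma linear_funB (f : V -> W) x y : linear f -> f (x - y) = f x - f y.
Proof. by move=> hf; rewrite linear_funD // linear_funN. Qed.

Lemma linear_fun_comp (f : V -> W) (g : W -> U) :
  linear f -> linear g -> linear (g \o f).
Proof. by move=> hf hg a x y /=; rewrite hf hg. Qed.

Lemma linear_fun_id : linear (@idfun V).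
Proof. by []. Qed.

End Linear.

Section Tmap.
Context {V V' W W' : lmodType k}.

(* Only meaningful for linear [f] and [g], see [tlift]. *)
Definition tmap (f : V -> V') (g : W -> W') : V \ox W -> V' \ox W' :=
  tlift (fun v w => f v \ox g w).

Context (f : V -> V') (g : W -> W') (hf : linear f) (hg : linear g).

Lemma tmap_bilinear : bilinear_map (fun v w => f v \ox g w).
Proof.
have [tl tr] := @tens_bilinear V' W'.
by split=> [w a v v'|v a w w']; rewrite ?hf ?hg ?tl ?tr.
Qed.

Lemma tmap_linear : linear (tmap f g).
Proof. exact/tlift_linear/tmap_bilinear. Qed.

Lemma tmap_tens v w : tmap f g (v \ox w) = f v \ox g w.
Proof. by rewrite /tmap tlift_tens //; exact: tmap_bilinear. Qed.

End Tmap.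

Lemma tmap_comp V V' V'' W W' W'' (f : V -> V') (f' : V' -> V'')
    (g : W -> W') (g' : W' -> W'') t :
  linear f -> linear f' -> linear g -> linear g' ->
  tmap f' g' (tmap f g t) = tmap (f' \o f) (g' \o g) t.
Proof.
move=> hf hf' hg hg'; have hff := linear_fun_comp hf hf'.
have hgg := linear_fun_comp hg hg'.
apply: (@tensor_ext _ _ _ (tmap f' g' \o tmap f g)) t => [||v w] /=.
- by apply: linear_fun_comp; exact: tmap_linear.
- exact: tmap_linear.
- by rewrite !tmap_tens.
Qed.

Lemma tmap_id V W (f : V -> V) (g : W -> W) t :
  f =1 id -> g =1 id -> tmap f g t = t.
Proof.
move=> f1 g1; have hf : linear f by move=> a x y; rewrite !f1.
have hg : linear g by move=> a x y; rewrite !g1.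
apply: (@tensor_ext _ _ _ (tmap f g) idfun) t => //; first exact: tmap_linear.
by move=> v w; rewrite tmap_tens // f1 g1.
Qed.

Section Assoc.
Context {U V W : lmodType k}.

Definition tassoc : (U \ox V) \ox W -> U \ox (V \ox W) :=
  tlift (fun (t : U \ox V) (w : W) => tlift (fun u v => u \ox (v \ox w)) t).

Lemma tassoc_bilinear1 (w : W) : bilinear_map (fun (u : U) (v : V) => u \ox (v \ox w)).
Proof.
have [tl tr] := @tens_bilinear U (V \ox W)%type; have [sl sr] := @tens_bilinear V W.
by split=> [v a u u'|u a v v']; rewrite ?tl ?sl ?tr.
Qed.

Lemma tassoc_bilinear :
  bilinear_map (fun (t : U \ox V) (w : W) => tlift (fun u v => u \ox (v \ox w)) t).
Proof.
split=> [w|t a w w']; first exact/tlift_linear/tassoc_bilinear1.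
have [tl tr] := @tens_bilinear U (V \ox W)%type; have [sl sr] := @tens_bilinear V W.
elim/(@tensor_ind U V): t => [|b u v t IH].
  by rewrite !(linear_fun0 (tlift_linear (tassoc_bilinear1 _))) scaler0 addr0.
rewrite !(tlift_linear (tassoc_bilinear1 _)) IH.
rewrite !(tlift_tens _ _ (tassoc_bilinear1 _)) sr tr !scalerDr !scalerA.
by rewrite (mulrC a) addrACA.
Qed.

Lemma tassoc_linear : linear tassoc.
Proof. exact/tlift_linear/tassoc_bilinear. Qed.

Lemma tassoc_tens u v w : tassoc ((u \ox v) \ox w) = u \ox (v \ox w).
Proof.
rewrite /tassoc tlift_tens; last exact: tassoc_bilinear.
by rewrite tlift_tens //; exact: tassoc_bilinear1.
Qed.

Definition tassoc_inv : U \ox (V \ox W) -> (U \ox V) \ox W :=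
  tlift (fun (u : U) (t : V \ox W) => tlift (fun v w => (u \ox v) \ox w) t).

Lemma tassoc_inv_bilinear1 (u : U) :
  bilinear_map (fun (v : V) (w : W) => (u \ox v) \ox w).
Proof.
have [tl tr] := @tens_bilinear (U \ox V)%type W.
have [sl sr] := @tens_bilinear U V.
by split=> [w a v v'|v a w w']; rewrite ?sr ?tl ?tr.
Qed.

Lemma tassoc_inv_bilinear : bilinear_map
  (fun (u : U) (t : V \ox W) => tlift (fun v w => (u \ox v) \ox w) t).
Proof.
split=> [t a u u'|u]; last exact/tlift_linear/tassoc_inv_bilinear1.
have [tl tr] := @tens_bilinear (U \ox V)%type W.
have [sl sr] := @tens_bilinear U V.
elim/(@tensor_ind V W): t => [|b v w t IH].
  by rewrite !(linear_fun0 (tlift_linear (tassoc_inv_bilinear1 _))) scaler0 addr0.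
rewrite !(tlift_linear (tassoc_inv_bilinear1 _)) IH.
rewrite !(tlift_tens _ _ (tassoc_inv_bilinear1 _)) sl tl !scalerDr !scalerA.
by rewrite (mulrC a) addrACA.
Qed.

End Assoc.

Lemma tensor_ext3 U V W (X : lmodType k) (f g : (U \ox V) \ox W -> X) : linear f -> linear g ->
  (forall u v w, f ((u \ox v) \ox w) = g ((u \ox v) \ox w)) ->
  forall t, f t = g t.
Proof.
move=> hf hg e; apply: tensor_ext => // s w.
have [tl _] := @tens_bilinear (U \ox V)%type W.
apply: (@tensor_ext _ _ _ (fun s => f (s \ox w)) (fun s => g (s \ox w))) s.
- by move=> a s s'; rewrite tl hf.
- by move=> a s s'; rewrite tl hg.
- by move=> u v; exact: e.
Qed.

Lemma tassoc_natural U V W U' V' W' (f : U -> U') (g : V -> V') (h : W -> W') t :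
  linear f -> linear g -> linear h ->
  tassoc (tmap (tmap f g) h t) = tmap f (tmap g h) (tassoc t).
Proof.
move=> hf hg hh; have hfg := tmap_linear hf hg; have hgh := tmap_linear hg hh.
apply: (@tensor_ext3 _ _ _ _ (tassoc \o tmap (tmap f g) h)
          (tmap f (tmap g h) \o tassoc)) t => [||u v w] /=.
- by apply: linear_fun_comp; [exact: tmap_linear|exact: tassoc_linear].
- by apply: linear_fun_comp; [exact: tassoc_linear|exact: tmap_linear].
- by rewrite !(tmap_tens, tassoc_tens).
Qed.

Lemma tassocK U V W : cancel (@tassoc U V W) (@tassoc_inv U V W).
Proof.
apply: (@tensor_ext3 _ _ _ _ (@tassoc_inv U V W \o @tassoc U V W) idfun) => //.
  apply: linear_fun_comp; first exact: tassoc_linear.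
  exact/tlift_linear/tassoc_inv_bilinear.
move=> u v w /=; rewrite tassoc_tens /tassoc_inv.
rewrite (tlift_tens _ _ tassoc_inv_bilinear).
by rewrite (tlift_tens _ _ (tassoc_inv_bilinear1 _)).
Qed.

Section Tact.
Context {V X V' W Y W' : lmodType k}.

(* For bilinear [f] and [g], the bilinear map determined by
   (v \ox w, x \ox y) |-> f v x \ox g w y. *)
Definition tact (f : V -> X -> V') (g : W -> Y -> W')
    (s : V \ox W) (t : X \ox Y) : V' \ox W' :=
  tlift (fun x y => tmap (f^~ x) (g^~ y) s) t.

Context (f : V -> X -> V') (g : W -> Y -> W').
Hypotheses (hf : bilinear_map f) (hg : bilinear_map g).

Lemma tact_bilinear1 s : bilinear_map (fun x y => tmap (f^~ x) (g^~ y) s).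
Proof.
case: hf hg => fl fr [gl gr]; have [tl tr] := @tens_bilinear V' W'.
split=> [y a x x'|x a y y'];
  elim/(@tensor_ind V W): s => [|b v w t IH];
  rewrite ?(linear_fun0 (tmap_linear _ _)) ?scaler0 ?addr0 //;
  rewrite !(tmap_linear (fl _) (gl _)) IH !(tmap_tens (fl _) (gl _)).
- by rewrite fr tl !scalerDr !scalerA (mulrC a) addrACA.
- by rewrite gr tr !scalerDr !scalerA (mulrC a) addrACA.
Qed.

Lemma tact_bilinear : bilinear_map (tact f g).
Proof.
split=> [t a s s'|s]; last exact/tlift_linear/tact_bilinear1.
elim/(@tensor_ind X Y): t => [|b x y t]; rewrite /tact.
  by rewrite !(linear_fun0 (tlift_linear (tact_bilinear1 _))) ?scaler0 ?addr0.
rewrite !(tlift_linear (tact_bilinear1 _)) => ->.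
rewrite !(tlift_tens _ _ (tact_bilinear1 _)) (tmap_linear (hf.1 _) (hg.1 _)).
by rewrite !scalerDr !scalerA (mulrC a) addrACA.
Qed.

Lemma tact_tens v w x y : tact f g (v \ox w) (x \ox y) = f v x \ox g w y.
Proof.
by rewrite /tact (tlift_tens _ _ (tact_bilinear1 _)) (tmap_tens (hf.1 _) (hg.1 _)).
Qed.

End Tact.

End TensorTheory.

HB.mixin Record isCoalgebra (k : fieldType) C of GRing.Lmodule k C := {
  comul : {linear C -> tensor C C};
  counit : {linear C -> k^o};
  comulA : forall c : C,
    tassoc (tmap comul idfun (comul c)) = tmap idfun comul (comul c);
  comul_counitl : forall c : C,
    tlift (fun x y : C => (counit x : k) *: y) (comul c) = c;
  comul_counitr : forall c : C,
    tlift (fun x y : C => (counit y : k) *: x) (comul c) = c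
}.

#[short(type="coalgType")]
HB.structure Definition Coalgebra (k : fieldType) :=
  {C of isCoalgebra k C & GRing.Lmodule k C}.

HB.mixin Record Coalgebra_isBialgebra (k : fieldType) B
    of GRing.Algebra k B & Coalgebra k B := {
  comul1 : comul (1 : B) = 1 \ox 1;
  comulM : forall a b : B, comul (a * b) = tact *%R *%R (comul a) (comul b);
  counit1 : counit (1 : B) = (1 : k);
  counitM : forall a b : B, counit (a * b) = (counit a : k) * (counit b : k)
}.

#[short(type="bialgType")]
HB.structure Definition Bialgebra (k : fieldType) :=
  {B of GRing.Algebra k B & Coalgebra k B & Coalgebra_isBialgebra k B}.

HB.mixin Record isRightModule (k : fieldType) (B : algType k) M
    of GRing.Lmodule k M := {
  rscale : M -> B -> M;
  rscale_bilinear : bilinear_map rscale;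
  rscale1 : forall m : M, rscale m 1 = m;
  rscaleM : forall (m : M) (a b : B), rscale m (a * b) = rscale (rscale m a) b
}.

#[short(type="rightModType")]
HB.structure Definition RightModule (k : fieldType) (B : algType k) :=
  {M of isRightModule k B M & GRing.Lmodule k M}.

(* The diagonal action of [b] on [C \ox C] is the action of [comul b]
   componentwise; [b] acts on the trivial module [k] by [counit b]. *)
HB.mixin Record isModuleCoalgebra (k : fieldType) (B : bialgType k) C
    of Coalgebra k C & RightModule k B C := {
  comul_rscale : forall (c : C) (b : B),
    comul (rscale c b) = tact rscale rscale (comul c) (comul b);
  counit_rscale : forall (c : C) (b : B),
    counit (rscale c b) = (counit c : k) * (counit b : k)
}.

#[short(type="modCoalgType")]
HB.structure Definition ModuleCoalgebra (k : fieldType) (B : bialgType k) :=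
  {C of Coalgebra k C & RightModule k B C & isModuleCoalgebra k B C}.

Section GeneralizedInverse.
Context {k : fieldType} {V U : lmodType k} (f : V -> U) (hf : linear f).

(* Graphs of the partial linear sections of [f]. *)
Let partial_section (G : set (U * V)) :=
  [/\ forall (a : k) x y, G x -> G y -> G (a *: x + y),
      forall v, G (0, v) -> v = 0
    & forall u v w, G (u, v) -> u = f w -> f v = u].

Lemma generalized_inverse :
  exists2 g : U -> V, linear g & forall v, f (g (f v)) = f v.
Proof.
have chain (F : set (set (U * V))) : F `<=` partial_section ->
    total_on F subset -> partial_section (\bigcup_(X in F) X).
  move=> FP Ftot; split=> [a x y [X FX Xx] [Y FY Yy]|v [X FX]|u v w [X FX]].
  - have [XY|YX] := Ftot _ _ FX FY.
      by exists Y => //; have [h _ _] := FP _ FY; apply: h => //; exact: XY.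
    by exists X => //; have [h _ _] := FP _ FX; apply: h => //; exact: YX.
  - by have [_ h _] := FP _ FX; exact: h.
  - by have [_ _ h] := FP _ FX; exact: h.
have [G [[Glin Gfun Gsec] Gmax]] := Zorn_bigcup chain.
have G00 : G (0, 0).
  apply: contrapT => nG.
  have G0 x : ~ G x.
    move=> Gx; apply: nG; have := Glin (-1) _ _ Gx Gx.
    by rewrite scaleN1r addNr.
  apply: (Gmax [set (0, 0)]).
    split; first by move=> x /G0.
    by move=> /(_ (0, 0) erefl) /G0.
  split=> [a x y -> ->|v [->]|u v w [-> ->] _] //=.
    by rewrite scaler0 addr0.
  exact: linear_fun0.
have GD x y : G x -> G y -> G (x + y).
  by move=> Gx Gy; rewrite -[x]scale1r; exact: Glin.
have GZ a x : G x -> G (a *: x).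
  by move=> Gx; rewrite -[_ *: _]addr0; exact: Glin.
have GN x : G x -> G (- x) by rewrite -scaleN1r; exact: GZ.
have Guniq u v v' : G (u, v) -> G (u, v') -> v = v'.
  move=> h h'; apply/eqP; rewrite -subr_eq0; apply/eqP/Gfun.
  by have := GD _ _ h (GN _ h'); rewrite -(subrr u).
have Gtot u : exists v, G (u, v).
  apply: contrapT => nu.
  have [v0 v0P] : exists v0, forall s t w,
      G (s, t) -> s + u = f w -> f (t + v0) = s + u.
    have [[s0 [t0 [w0 [Gs0 e0]]]]|no] :=
        pselect (exists s t w, G (s, t) /\ s + u = f w); last first.
      by exists 0 => s t w Gst e; case: no; exists s, t, w.
    exists (w0 - t0) => s t w Gst e.
    have Gd := GD _ _ Gst (GN _ Gs0).
    have ed : s - s0 = f (w - w0).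
      by rewrite linear_funB // -e -e0 opprD addrACA subrr addr0.
    have := Gsec _ _ _ Gd ed; rewrite linear_funB // => eft.
    by rewrite linear_funD // linear_funB // addrCA eft -e0 addrC addrA subrK.
  pose H := [set x : U * V | exists a : k, exists2 p : U * V, G p &
               x = a *: (u, v0) + p].
  apply: (Gmax H).
    split; first by move=> x Gx; exists 0, x => //; rewrite scale0r add0r.
    move=> HG; apply: nu; exists v0; apply: HG.
    by exists 1, (0, 0) => //; rewrite scale1r addr0.
  have Hsec s t w : H (s, t) -> s = f w -> f t = s.
    move=> [a [[s1 t1]] Gp [-> ->]].
    have [->|a0] := eqVneq a 0.
      by rewrite !scale0r !add0r; exact: Gsec.
    move=> e; have Gp' : G (a^-1 *: s1, a^-1 *: t1) by exact: (GZ a^-1 _ Gp).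
    have e' : a^-1 *: s1 + u = f (a^-1 *: w).
      by rewrite linear_funZ // -e scalerDr scalerA mulVf // scale1r addrC.
    have /(congr1 (fun z => a *: z)) := v0P _ _ _ Gp' e'.
    rewrite -linear_funZ // !scalerDr !scalerA mulfV // !scale1r.
    by rewrite addrC [RHS]addrC.
  split=> //.
    move=> c x y [a [p Gp ->]] [b [q Gq ->]].
    exists (c * a + b), (c *: p + q); first exact: Glin.
    by rewrite scalerDr scalerA addrACA -scalerDl.
  move=> v [a [[s1 t1]] Gp [es ->]].
  have a0 : a = 0.
    apply/eqP; apply: contrapT => /negP a0; apply: nu.
    exists (- (a^-1 *: t1)).
    suff -> : u = - (a^-1 *: s1) by exact: (GN _ (GZ a^-1 _ Gp)).
    apply: (scalerI a0); rewrite scalerN scalerA mulfV // scale1r.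
    by apply/eqP; rewrite -addr_eq0 -es.
  move: es Gp; rewrite a0 !scale0r !add0r => <-; exact: Gfun.
have [g gP] := choice Gtot.
exists g => [a x y|v]; last exact: Gsec (gP (f v)) erefl.
apply: (Guniq (a *: x + y)); first exact: gP.
exact: (Glin a _ _ (gP x) (gP y)).
Qed.

End GeneralizedInverse.

Section SubspaceType.
Context {k : fieldType} (V : lmodType k).

Record subspaceType := Subspace {
  subspace_set :> set V;
  subspaceP : subspace subspace_set
}.

Record subspace_elt (X : subspaceType) : Type := SubspaceElt {
  elt_val : V;
  elt_valP : elt_val \in (X : set V)
}.

Context (X : subspaceType).

HB.instance Definition _ := [isSub for @elt_val X].
HB.instance Definition _ := [Choice of subspace_elt X by <:].
HB.instance Definition _ := GRing.SubChoice_isSubLmodule.Build k V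
  (fun x => x \in (X : set V)) (subspace_elt X)
  (subspace_submod_closed (subspaceP X)).

Lemma elt_in (x : subspace_elt X) : subspace_set X (elt_val x).
Proof. exact/set_mem/elt_valP. Qed.

Definition elt_of (v : V) (hv : subspace_set X v) : subspace_elt X := SubspaceElt (mem_set hv).

Lemma elt_val_linear : linear (@elt_val X).
Proof. by move=> a x y; exact: (linearP (\val : subspace_elt X -> V)). Qed.

Lemma elt_val_inj : injective (@elt_val X).
Proof. exact: val_inj. Qed.

Lemma subspace_retraction :
  exists2 r : V -> subspace_elt X, linear r & cancel (@elt_val X) r.
Proof.
have [r rlin rP] := generalized_inverse elt_val_linear.
by exists r => // x; apply: elt_val_inj; rewrite rP.
Qed.

Lemma subspace_projection : exists p : V -> V,
  [/\ linear p, forall v, subspace_set X (p v) & forall v, subspace_set X v -> p v = v].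
Proof.
have [r rlin rK] := subspace_retraction.
exists (@elt_val X \o r); split=> [|v|v Xv] /=.
- exact: linear_fun_comp rlin elt_val_linear.
- exact: elt_in.
- by rewrite -[v]/(elt_val (elt_of Xv)) rK.
Qed.

End SubspaceType.

Section TensorSubspace.
Context {k : fieldType}.
Implicit Types V W U : lmodType k.

(* The image of [X \ox Y] in [V \ox W]. *)
Definition tsub V W (X : set V) (Y : set W) : set (V \ox W) :=
  [set t | exists2 s : seq (V * W),
     (forall p, p \in s -> X p.1 /\ Y p.2) & t = \sum_(p <- s) p.1 \ox p.2].

Lemma tsub_subspace V W (X : set V) (Y : set W) :
  subspace X -> subspace (tsub X Y).
Proof.
move=> hX; split; first by exists [::]; rewrite ?big_nil.
have [tl tr] := @tens_bilinear k V W.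
move=> a _ _ [s hs ->] [s' hs' ->].
exists ([seq (a *: p.1, p.2) | p <- s] ++ s').
  move=> p; rewrite mem_cat => /orP[/mapP[q qs ->]|/hs' //] /=.
  by have [Xq Yq] := hs _ qs; split=> //; exact: subspaceZ.
rewrite big_cat big_map scaler_sumr /=; congr (_ + _).
by apply: eq_bigr => p _; rewrite (linear_funZ _ _ (tl _)).
Qed.

Lemma tsub_tens V W (X : set V) (Y : set W) v w :
  X v -> Y w -> tsub X Y (v \ox w).
Proof.
move=> Xv Yw; exists [:: (v, w)]; last by rewrite big_seq1.
by move=> p; rewrite inE => /eqP ->.
Qed.

Lemma tsubS V W (X X' : set V) (Y Y' : set W) :
  X `<=` X' -> Y `<=` Y' -> tsub X Y `<=` tsub X' Y'.
Proof.
move=> hX hY t [s hs ->]; exists s => // p /hs[Xp Yp].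
by split; [exact: hX|exact: hY].
Qed.

Lemma tsub_ind V W (X : set V) (Y : set W) (S : set (V \ox W)) : subspace S ->
  (forall v w, X v -> Y w -> S (v \ox w)) -> tsub X Y `<=` S.
Proof.
move=> hS h t [s hs ->]; apply: subspace_sum => // p /hs[Xp Yp]; exact: h.
Qed.

Lemma linear_eq_subspace V U (f g : V -> U) :
  linear f -> linear g -> subspace [set t | f t = g t].
Proof.
move=> hf hg; split=> [|a x y] /=; first by rewrite !linear_fun0.
by rewrite hf hg => -> ->.
Qed.

Lemma tmap_tsub V W V' W' (f : V -> V') (g : W -> W') (X : set V') (Y : set W') t :
  linear f -> linear g -> subspace X ->
  (forall v, X (f v)) -> (forall w, Y (g w)) -> tsub X Y (tmap f g t).
Proof.
move=> hf hg hX fX gY; have [h0 h] := tsub_subspace Y hX.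
elim/(@tensor_ind k V W): t => [|a v w t IH].
  by rewrite (linear_fun0 (tmap_linear hf hg)).
by rewrite (tmap_linear hf hg) tmap_tens //; apply: h => //; exact: tsub_tens.
Qed.

Lemma tsub_tmap V W V' W' (f : V -> V') (g : W -> W') (X : set V) (Y : set W)
    (X' : set V') (Y' : set W') t :
  linear f -> linear g -> subspace X' ->
  (forall v, X v -> X' (f v)) -> (forall w, Y w -> Y' (g w)) ->
  tsub X Y t -> tsub X' Y' (tmap f g t).
Proof.
move=> hf hg hX fX gY [s hs ->].
rewrite (big_morph _ (fun x y => linear_funD x y (tmap_linear hf hg))
  (linear_fun0 (tmap_linear hf hg))).
apply: subspace_sum; first exact: tsub_subspace.
by move=> p /hs[Xp Yp]; rewrite tmap_tens //; apply: tsub_tens; auto.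
Qed.

Lemma tmap_tsub_id V W (f : V -> V) (g : W -> W) (X : set V) (Y : set W) t :
  linear f -> linear g -> (forall v, X v -> f v = v) ->
  (forall w, Y w -> g w = w) -> tsub X Y t -> tmap f g t = t.
Proof.
move=> hf hg fX gY; apply: (tsub_ind (S := [set t | tmap f g t = t])) => /=.
  exact: (@linear_eq_subspace _ _ (tmap f g) idfun (tmap_linear hf hg)).
by move=> v w Xv Yw; rewrite tmap_tens // fX // gY.
Qed.

Lemma tmap_tsub_0l V W V' W' (f : V -> V') (g : W -> W') (X : set V) (Y : set W) t :
  linear f -> linear g -> (forall v, X v -> f v = 0) -> tsub X Y t ->
  tmap f g t = 0.
Proof.
move=> hf hg fX; apply: (tsub_ind (S := [set t | tmap f g t = 0])) => /=.
  by apply: (@linear_eq_subspace _ _ (tmap f g) (fun=> 0) (tmap_linear hf hg)) => a x y;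
     rewrite scaler0 addr0.
have [tl _] := @tens_bilinear k V' W'.
by move=> v w Xv Yw; rewrite tmap_tens // fX // (linear_fun0 (tl _)).
Qed.

Lemma tmap_tsub_0r V W V' W' (f : V -> V') (g : W -> W') (X : set V) (Y : set W) t :
  linear f -> linear g -> (forall w, Y w -> g w = 0) -> tsub X Y t ->
  tmap f g t = 0.
Proof.
move=> hf hg gY; apply: (tsub_ind (S := [set t | tmap f g t = 0])) => /=.
  by apply: (@linear_eq_subspace _ _ (tmap f g) (fun=> 0) (tmap_linear hf hg)) => a x y;
     rewrite scaler0 addr0.
have [_ tr] := @tens_bilinear k V' W'.
by move=> v w Xv Yw; rewrite tmap_tens // gY // (linear_fun0 (tr _)).
Qed.

Lemma linear_compl V (p : V -> V) : linear p -> linear (fun v => v - p v).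
Proof.
by move=> hp a x y; rewrite hp opprD addrACA scalerBr.
Qed.

Lemma tmap_compll V W W' (p : V -> V) (g : W -> W') t : linear p -> linear g ->
  tmap idfun g t = tmap p g t + tmap (fun v => v - p v) g t.
Proof.
move=> hp hg; have hq := linear_compl hp.
have [tl _] := @tens_bilinear k V W'.
apply: (@tensor_ext _ _ _ _ (tmap idfun g)
  (fun t => tmap p g t + tmap (fun v => v - p v) g t)) t => [||v w].
- exact: tmap_linear.
- move=> a x y; rewrite !(tmap_linear _ hg) //.
  by rewrite scalerDr addrACA.
- by rewrite !tmap_tens // -(linear_funD _ _ (tl _)) addrC subrK.
Qed.

Lemma tmap_complr V W V' (f : V -> V') (p : W -> W) t : linear f -> linear p ->
  tmap f idfun t = tmap f p t + tmap f (fun v => v - p v) t.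
Proof.
move=> hf hp; have hq := linear_compl hp.
have [_ tr] := @tens_bilinear k V' W.
apply: (@tensor_ext _ _ _ _ (tmap f idfun)
  (fun t => tmap f p t + tmap f (fun v => v - p v) t)) t => [||v w].
- exact: tmap_linear.
- move=> a x y; rewrite !(tmap_linear hf) //.
  by rewrite scalerDr addrACA.
- by rewrite !tmap_tens // -(linear_funD _ _ (tr _)) addrC subrK.
Qed.

Lemma tmap_kerl V W U (f : V -> U) (t : V \ox W) : linear f ->
  tmap f idfun t = 0 -> tsub [set v | f v = 0] setT t.
Proof.
move=> hf e; have [g hg gP] := generalized_inverse hf.
have hgf := linear_fun_comp hf hg; have hq := linear_compl hgf.
rewrite -[t](@tmap_id _ _ _ idfun idfun) // (tmap_compll _ hgf) //.
rewrite -[tmap (g \o f) _ t]/(tmap (g \o f) (idfun \o idfun) t) -tmap_comp // e.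
rewrite (linear_fun0 (tmap_linear _ _)) // add0r.
apply: tmap_tsub => // [|v] /=; last by rewrite linear_funB // gP subrr.
split=> [|a x y] /=; first exact: linear_fun0.
by rewrite hf => -> ->; rewrite scaler0 addr0.
Qed.

Lemma tmap_kerr V W U (f : W -> U) (t : V \ox W) : linear f ->
  tmap idfun f t = 0 -> tsub setT [set v | f v = 0] t.
Proof.
move=> hf e; have [g hg gP] := generalized_inverse hf.
have hgf := linear_fun_comp hf hg; have hq := linear_compl hgf.
rewrite -[t](@tmap_id _ _ _ idfun idfun) // (tmap_complr _ _ hgf) //.
rewrite -[tmap _ (g \o f) t]/(tmap (idfun \o idfun) (g \o f) t) -tmap_comp // e.
rewrite (linear_fun0 (tmap_linear _ _)) // add0r.
by apply: tmap_tsub => // w /=; rewrite linear_funB // gP subrr.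
Qed.

Lemma tsubI V W (X : set V) (Y : set W) t : subspace X -> subspace Y ->
  tsub X setT t -> tsub setT Y t -> tsub X Y t.
Proof.
move=> hX hY tX tY.
have [p [hp pX pid]] := subspace_projection (Subspace hX).
have [q [hq qY qid]] := subspace_projection (Subspace hY).
rewrite -(@tmap_tsub_id _ _ p idfun _ _ _ _ _ pid _ tX) //.
rewrite -(@tmap_tsub_id _ _ idfun q _ _ _ _ _ _ qid tY) //.
by rewrite tmap_comp //; apply: tmap_tsub => //; exact: linear_fun_comp.
Qed.

End TensorSubspace.

Section SubmoduleCoalgebra.
Context {k : fieldType} {B : bialgType k}.

Record submodCoalg (C : modCoalgType B) := SubmodCoalg {
  submod_space :> subspaceType C;
  submod_comul : forall c, subspace_set submod_space c ->
    tsub submod_space submod_space (comul c);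
  submod_rscale : forall c (b : B), subspace_set submod_space c ->
    subspace_set submod_space (rscale c b)
}.

Lemma submodCoalg_ext (C : modCoalgType B) (D E : submodCoalg C) :
  (D : set C) = (E : set C) -> D = E.
Proof.
case: D E => [[X hX] hD rD] [[Y hY] hE rE] /= e; case: _ / e in hY hE rE *.
by rewrite (Prop_irrelevance hY hX) in hE rE *;
  rewrite (Prop_irrelevance hE hD) (Prop_irrelevance rE rD).
Qed.

Section Induced.
Context {C : modCoalgType B} (D : submodCoalg C).

(* The module coalgebra structure of [D] on its own carrier; its operations are
   the ones which make the inclusion [elt_val] into [C] a morphism. *)
Definition submod_carrier : Type := subspace_elt D.

HB.instance Definition _ := GRing.Lmodule.on submod_carrier.

Local Notation incl := (@elt_val k C D : submod_carrier -> C).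

Lemma incl_linear : linear incl.
Proof. exact: elt_val_linear. Qed.

Lemma incl_retraction :
  exists2 r : C -> submod_carrier, linear r & cancel incl r.
Proof. exact: subspace_retraction. Qed.

Lemma tmap_incl_inj : injective (tmap incl incl).
Proof.
have [r hr rK] := incl_retraction; apply: (can_inj (g := tmap r r)) => t.
rewrite tmap_comp //; try exact: incl_linear.
by apply: tmap_id => x /=; rewrite rK.
Qed.

Lemma incl_comul_exists (x : submod_carrier) :
  exists t : submod_carrier \ox submod_carrier,
    tmap incl incl t = comul (incl x).
Proof.
have [r hr rK] := incl_retraction; exists (tmap r r (comul (incl x))).
have rid v : subspace_set D v -> (incl \o r) v = v.
  by move=> Dv; rewrite /= -[v]/(incl (elt_of Dv)) rK.
have hp := linear_fun_comp hr incl_linear.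
rewrite tmap_comp //; try exact: incl_linear.
by apply: (tmap_tsub_id hp hp rid rid); apply/submod_comul/elt_in.
Qed.

Definition sub_comul (x : submod_carrier) : submod_carrier \ox submod_carrier :=
  sval (cid (incl_comul_exists x)).

Lemma sub_comulE x : tmap incl incl (sub_comul x) = comul (incl x).
Proof. exact: svalP (cid (incl_comul_exists x)). Qed.

Definition sub_counit (x : submod_carrier) : k^o := counit (incl x).

Definition sub_rscale (x : submod_carrier) (b : B) : submod_carrier :=
  elt_of (submod_rscale b (elt_in x)).

Fact sub_comul_linear : linear sub_comul.
Proof.
move=> a x y; apply: tmap_incl_inj.
rewrite (tmap_linear incl_linear incl_linear) !sub_comulE.
by rewrite incl_linear linearP.
Qed.

Fact sub_counit_linear : linear sub_counit.
Proof. by move=> a x y; rewrite /sub_counit incl_linear linearP. Qed.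

HB.instance Definition _ := GRing.isLinear.Build k submod_carrier
  (submod_carrier \ox submod_carrier)%type _ sub_comul sub_comul_linear.
HB.instance Definition _ := GRing.isLinear.Build k submod_carrier
  k^o _ sub_counit sub_counit_linear.

Fact sub_comulA x :
  tassoc (tmap sub_comul idfun (sub_comul x)) =
  tmap idfun sub_comul (sub_comul x).
Proof.
have hi := incl_linear; have hii := tmap_linear hi hi.
have hs := sub_comul_linear.
have hc : linear (@comul k C) by move=> a u v; rewrite linearP.
have inj : injective (tmap incl (tmap incl incl)).
  have [r hr rK] := incl_retraction; have hrr := tmap_linear hr hr.
  apply: (can_inj (g := tmap r (tmap r r))) => t.
  rewrite tmap_comp //; apply: tmap_id => y /=; first by rewrite rK.
  by rewrite tmap_comp //; apply: tmap_id => z /=; rewrite rK.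
apply: inj; rewrite -tassoc_natural // !tmap_comp //.
have -> : tmap incl incl \o sub_comul = @comul k C \o incl.
  by apply: funext => y /=; rewrite sub_comulE.
rewrite -[incl \o idfun]/(idfun \o incl).
by rewrite -!tmap_comp // !sub_comulE comulA.
Qed.

Lemma counitl_bilinear (E : coalgType k) :
  bilinear_map (fun x y : E => (counit x : k) *: y).
Proof.
split=> [y a x x'|x a y y'] /=; first by rewrite linearP scalerDl -scalerA.
by rewrite scalerDr !scalerA mulrC.
Qed.

Lemma counitr_bilinear (E : coalgType k) :
  bilinear_map (fun x y : E => (counit y : k) *: x).
Proof.
split=> [y a x x'|x a y y'] /=; last by rewrite linearP scalerDl -scalerA.
by rewrite scalerDr !scalerA mulrC.
Qed.

Lemma sub_counitl_bilinear :
  bilinear_map (fun x y : submod_carrier => (sub_counit x : k) *: y).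
Proof.
split=> [y a x x'|x a y y'] /=; first by rewrite linearP scalerDl -scalerA.
by rewrite scalerDr !scalerA mulrC.
Qed.

Lemma sub_counitr_bilinear :
  bilinear_map (fun x y : submod_carrier => (sub_counit y : k) *: x).
Proof.
split=> [y a x x'|x a y y'] /=; last by rewrite linearP scalerDl -scalerA.
by rewrite scalerDr !scalerA mulrC.
Qed.

Fact sub_comul_counitl x :
  tlift (fun x y : submod_carrier => (sub_counit x : k) *: y) (sub_comul x) = x.
Proof.
have hi := incl_linear.
apply: elt_val_inj; rewrite -[RHS]comul_counitl -[in RHS]sub_comulE.
move: (sub_comul x) => t.
apply: (@tensor_ext _ _ _ _
  (incl \o tlift (fun x y : submod_carrier => (sub_counit x : k) *: y))
  (tlift (fun x y : C => (counit x : k) *: y) \o tmap incl incl)) t.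
- apply: linear_fun_comp => //; exact/tlift_linear/sub_counitl_bilinear.
- apply: linear_fun_comp; first exact: tmap_linear.
  exact/tlift_linear/counitl_bilinear.
move=> v w; rewrite /= tmap_tens // (tlift_tens _ _ sub_counitl_bilinear).
by rewrite (tlift_tens _ _ (counitl_bilinear _)) linear_funZ.
Qed.

Fact sub_comul_counitr x :
  tlift (fun x y : submod_carrier => (sub_counit y : k) *: x) (sub_comul x) = x.
Proof.
have hi := incl_linear.
apply: elt_val_inj; rewrite -[RHS]comul_counitr -[in RHS]sub_comulE.
move: (sub_comul x) => t.
apply: (@tensor_ext _ _ _ _
  (incl \o tlift (fun x y : submod_carrier => (sub_counit y : k) *: x))
  (tlift (fun x y : C => (counit y : k) *: x) \o tmap incl incl)) t.
- apply: linear_fun_comp => //; exact/tlift_linear/sub_counitr_bilinear.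
- apply: linear_fun_comp; first exact: tmap_linear.
  exact/tlift_linear/counitr_bilinear.
move=> v w; rewrite /= tmap_tens // (tlift_tens _ _ sub_counitr_bilinear).
by rewrite (tlift_tens _ _ (counitr_bilinear _)) linear_funZ.
Qed.

HB.instance Definition _ := isCoalgebra.Build k submod_carrier
  sub_comulA sub_comul_counitl sub_comul_counitr.

Fact sub_rscale_bilinear : bilinear_map sub_rscale.
Proof.
have [rl rr] := @rscale_bilinear k B C.
split=> [b a x y|x a b c]; apply: elt_val_inj; rewrite [RHS]incl_linear.
  by rewrite -[LHS]/(rscale (incl (a *: x + y)) b) incl_linear rl.
exact: rr.
Qed.

Fact sub_rscale1 x : sub_rscale x 1 = x.
Proof. by apply: elt_val_inj; exact: rscale1. Qed.

Fact sub_rscaleM x a b : sub_rscale x (a * b) = sub_rscale (sub_rscale x a) b.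
Proof. by apply: elt_val_inj; exact: rscaleM. Qed.

HB.instance Definition _ := isRightModule.Build k B submod_carrier
  sub_rscale_bilinear sub_rscale1 sub_rscaleM.

Fact sub_comul_rscale (x : submod_carrier) (b : B) :
  comul (rscale x b) = tact rscale rscale (comul x) (comul b).
Proof.
have hi := incl_linear; have hii := tmap_linear hi hi.
apply: tmap_incl_inj; rewrite sub_comulE /= comul_rscale.
rewrite -[elt_val x]/(incl x) -sub_comulE -[comul x]/(sub_comul x).
have rb := @rscale_bilinear k B C.
have srb := @rscale_bilinear k B submod_carrier.
have [tl tr] := tact_bilinear rb rb; have [sl sr] := tact_bilinear srb srb.
move: (sub_comul x) (comul b) => s t.
apply: (@tensor_ext _ _ _ _ (tact rscale rscale (tmap incl incl s))
  (tmap incl incl \o tact rscale rscale s)) t => //.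
  exact: linear_fun_comp.
move=> u v; apply: (@tensor_ext _ _ _ _
  ((tact rscale rscale)^~ (u \ox v) \o tmap incl incl)
  (tmap incl incl \o (tact rscale rscale)^~ (u \ox v))) s.
- exact: linear_fun_comp.
- exact: linear_fun_comp.
by move=> y z; rewrite /= !(tact_tens, tmap_tens).
Qed.

Fact sub_counit_rscale (x : submod_carrier) (b : B) :
  counit (rscale x b) = (counit x : k) * (counit b : k).
Proof. exact: counit_rscale. Qed.

HB.instance Definition _ := isModuleCoalgebra.Build k B submod_carrier
  sub_comul_rscale sub_counit_rscale.

Definition modCoalg_of : modCoalgType B := submod_carrier.

End Induced.

Section Wedge.
Context {C : modCoalgType B}.

Definition wedge_set (X Y : set C) : set C :=
  [set c | exists s t, [/\ tsub X setT s, tsub setT Y t & comul c = s + t]].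

Lemma comul_linear (E : coalgType k) : linear (@comul k E).
Proof. by move=> a u v; rewrite linearP. Qed.

Lemma wedge_subspace (X Y : set C) :
  subspace X -> subspace Y -> subspace (wedge_set X Y).
Proof.
move=> hX hY.
have [X0 XP] := tsub_subspace (V := C) (W := C) (X := X) setT hX.
have [Y0 YP] : subspace (tsub (V := C) (W := C) setT Y) by exact: tsub_subspace.
split; first by exists 0, 0; split=> //; rewrite linear0 addr0.
move=> a x y [s [t [Xs Yt e]]] [s' [t' [Xs' Yt' e']]].
exists (a *: s + s'), (a *: t + t'); split; [exact: XP|exact: YP|].
by rewrite comul_linear e e' scalerDr addrACA.
Qed.

Context (D E : submodCoalg C).

Lemma wedge_comul c : wedge_set D E c ->
  tsub (wedge_set D E) (wedge_set D E) (comul c).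
Proof.
have hS := wedge_subspace (subspaceP D) (subspaceP E).
have [p [hp pD pid]] := subspace_projection D.
have [q [hq qE qid]] := subspace_projection E.
pose p' v := v - p v; pose q' v := v - q v.
have hp' : linear p' by exact: linear_compl.
have hq' : linear q' by exact: linear_compl.
have p'D v : subspace_set D v -> p' v = 0 by move=> Dv; rewrite /p' pid ?subrr.
have q'E v : subspace_set E v -> q' v = 0 by move=> Ev; rewrite /q' qid ?subrr.
have hpq := tmap_linear hp' hq'.
have hc := @comul_linear C.
have hF : linear (tmap p' q' \o comul) by exact: linear_fun_comp.
have ker v : (tmap p' q' (comul v) = 0) <-> wedge_set D E v.
  split=> [e|[s [t [Ds Et ->]]]]; last first.
    by rewrite linear_funD // (tmap_tsub_0l hp' hq' p'D Ds)
      (tmap_tsub_0r hp' hq' q'E Et) addr0.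
  exists (tmap p idfun (comul v)), (tmap p' q (comul v)); split.
  - by apply: tmap_tsub => //; exact: subspaceP.
  - by apply: tmap_tsub.
  rewrite -[LHS](@tmap_id _ _ _ idfun idfun) // (tmap_compll _ hp) //.
  by rewrite (tmap_complr _ hp' hq) -[X in _ + (_ + X) = _]/(tmap p' q' _) e addr0.
have kerE : [set v | (tmap p' q' \o comul) v = 0] = wedge_set D E.
  by apply/seteqP; split=> v /ker.
move=> [s [t [Ds Et e]]]; apply: tsubI => //.
- rewrite -kerE; apply: tmap_kerl => //.
  apply: (can_inj (@tassocK _ _ _ _)).
  rewrite -[tmap _ idfun _]/(tmap (tmap p' q' \o comul) (idfun \o idfun) _).
  rewrite -tmap_comp // tassoc_natural // comulA.
  rewrite (linear_fun0 tassoc_linear) tmap_comp //; last exact: tmap_linear.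
  rewrite e linear_funD; last first.
    by apply: tmap_linear => //; apply: linear_fun_comp => //; exact: tmap_linear.
  have hG : linear (tmap q' idfun \o @comul k C).
    by apply: linear_fun_comp => //; exact: tmap_linear.
  rewrite (tmap_tsub_0l _ _ _ Ds) // (tmap_tsub_0r _ _ _ Et) ?addr0 // => w Ew /=.
  exact: (tmap_tsub_0l hq' _ q'E (submod_comul Ew)).
- rewrite -kerE; apply: tmap_kerr => //.
  rewrite -[tmap idfun _ _]/(tmap (idfun \o idfun) (tmap p' q' \o comul) _).
  rewrite -tmap_comp // -comulA -tassoc_natural // tmap_comp //;
    last exact: tmap_linear.
  have hG : linear (tmap idfun p' \o @comul k C).
    by apply: linear_fun_comp => //; exact: tmap_linear.
  have hGq := tmap_linear hG hq'.
  rewrite e linear_funD // (tmap_tsub_0r _ _ _ Et) // (tmap_tsub_0l _ _ _ Ds) //.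
    by rewrite addr0 (linear_fun0 tassoc_linear).
  by move=> w Dw /=; exact: (tmap_tsub_0r _ hp' p'D (submod_comul Dw)).
Qed.

Lemma wedge_rscale c (b : B) : wedge_set D E c -> wedge_set D E (rscale c b).
Proof.
have rb := @rscale_bilinear k B C; have [tl tr] := tact_bilinear rb rb.
have stable (X Y : set C) (u : C \ox C) (z : B \ox B) : subspace X ->
    (forall x a, X x -> X (rscale x a)) -> (forall y a, Y y -> Y (rscale y a)) ->
    tsub X Y u -> tsub X Y (tact rscale rscale u z).
  move=> hX Xr Yr Xu; have [h0 h] := tsub_subspace Y hX.
  elim/(@tensor_ind k B B): z => [|a x y z IH]; first by rewrite (linear_fun0 (tr _)).
  rewrite tr; apply: h => //.
  apply: (@tsub_ind _ _ _ X Y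
    [set u | tsub X Y (tact rscale rscale u (x \ox y))] _ _ _ Xu) => /=.
    split=> [|a' u1 u2 h1 h2] /=; first by rewrite (linear_fun0 (tl _)); exact: (tsub_subspace Y hX).1.
    by rewrite tl; apply: (tsub_subspace Y hX).2.
  by move=> v w Xv Yw; rewrite tact_tens //; apply: tsub_tens; auto.
move=> [s [t [Ds Et e]]].
exists (tact rscale rscale s (comul b)), (tact rscale rscale t (comul b)); split.
- by apply: stable => //; [exact: subspaceP|exact: submod_rscale].
- by apply: stable => //; exact: submod_rscale.
- by rewrite comul_rscale e (linear_funD _ _ (tl _)).
Qed.

Definition wedge : submodCoalg C := {|
  submod_space := Subspace (wedge_subspace (subspaceP D) (subspaceP E));
  submod_comul := wedge_comul;
  submod_rscale := wedge_rscale |}.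

End Wedge.

Section Sum.
Context {C : modCoalgType B} {I : Type} (D_ : I -> submodCoalg C).

Definition sum_set : set C :=
  [set c | exists s : seq {i : I & subspace_elt (D_ i)},
     c = \sum_(x <- s) elt_val (projT2 x)].

Lemma sum_sup i : (D_ i : set C) `<=` sum_set.
Proof.
move=> c Dc; exists [:: existT (fun i => subspace_elt (D_ i)) i (elt_of Dc)].
by rewrite big_seq1.
Qed.

Lemma sum_subspace : subspace sum_set.
Proof.
split=> [|a _ _ [s ->] [s' ->]]; first by exists [::]; rewrite big_nil.
exists ([seq existT (fun i => subspace_elt (D_ i)) (projT1 x) (a *: projT2 x)
        | x <- s] ++ s').
by rewrite big_cat big_map scaler_sumr.
Qed.

Lemma sum_min (S : set C) :
  subspace S -> (forall i, (D_ i : set C) `<=` S) -> sum_set `<=` S.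
Proof.
move=> hS h _ [s ->]; elim: s => [|x s IH]; first by rewrite big_nil; case: hS.
by rewrite big_cons; apply: subspaceD => //; apply: h; exact: elt_in.
Qed.

Lemma sum_comul c : sum_set c -> tsub sum_set sum_set (comul c).
Proof.
have [h0 h] : subspace (tsub sum_set sum_set) by exact/tsub_subspace/sum_subspace.
apply: (sum_min (S := [set c | tsub sum_set sum_set (comul c)])) => [|i d Dd] /=.
  by split=> [|a x y] /=; rewrite ?linear0 // linearP; exact: h.
exact: tsubS (@sum_sup i) (@sum_sup i) _ (submod_comul Dd).
Qed.

Lemma sum_rscale c (b : B) : sum_set c -> sum_set (rscale c b).
Proof.
have [h0 h] := sum_subspace; have [rl _] := @rscale_bilinear k B C.
apply: (sum_min (S := [set c | sum_set (rscale c b)])) => [|i d Dd] /=.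
  split=> [|a x y] /=; first by rewrite (linear_fun0 (rl b)).
  by rewrite (rl b); exact: h.
exact/(@sum_sup i)/submod_rscale.
Qed.

Definition submod_sum : submodCoalg C := {|
  submod_space := Subspace sum_subspace;
  submod_comul := sum_comul;
  submod_rscale := sum_rscale |}.

End Sum.

End SubmoduleCoalgebra.

(* [R] is a collection of objects, not assumed closed under isomorphism; a
   submodule coalgebra [D] of [C] belongs to [R] when [modCoalg_of D] does. The
   family in [radical_sum] may be empty. *)
Record radical_class (k : fieldType) (B : bialgType k)
    (R : modCoalgType B -> Prop) : Prop := {
  radical_nonempty : exists C, R C;
  radical_sub : forall C, R C ->
    forall D : submodCoalg C, R (modCoalg_of D);
  radical_sum : forall (C : modCoalgType B) (I : Type) (D_ : I -> submodCoalg C),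
    (forall i, R (modCoalg_of (D_ i))) -> R (modCoalg_of (submod_sum D_))
}.

Record idempotent_radical_class (k : fieldType) (B : bialgType k)
    (R : modCoalgType B -> Prop) : Prop := {
  idempotent_radical :> radical_class R;
  idempotent_wedge : forall (C : modCoalgType B) (D E : submodCoalg C),
    R (modCoalg_of D) -> R (modCoalg_of E) -> R (modCoalg_of (wedge D E))
}.

Definition maximal_subcoalgebra_in (k : fieldType) (B : bialgType k)
    (R : modCoalgType B -> Prop) (C : modCoalgType B) (D : submodCoalg C) : Prop :=
  R (modCoalg_of D) /\
  forall E : submodCoalg C, R (modCoalg_of E) ->
    (D : set C) `<=` (E : set C) -> E = D.

(* Main.v *)
Require Import Defs.
From mathcomp Require Import all_boot all_algebra.
From mathcomp.classical Require Import classical_sets.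

Local Open Scope classical_set_scope.

(** By closure under sums ([radical_sum]), the sum of all [R]-subcoalgebras of [C] is again one. It
    contains all the others, so it is the largest, hence the only maximal one. *)

Theorem mainTheorem2 (k : fieldType) (B : bialgType k)
    (R : modCoalgType B -> Prop) (hR : idempotent_radical_class R)
    (C : modCoalgType B) :
  exists! D : submodCoalg C, maximal_subcoalgebra_in R D.
Proof.
(* Each index carries its own proof of membership in [R], as [radical_sum] requires. *)
pose D_ (E : {E : submodCoalg C | R (modCoalg_of E)}) := sval E.
pose D := submod_sum D_.
have RD : R (modCoalg_of D) by apply: (radical_sum hR) => -[].
have supD (E : submodCoalg C) :
    R (modCoalg_of E) -> (E : set C) `<=` (D : set C).
  by move=> RE; exact: (sum_sup (D_ := D_) (i := exist _ E RE)).
(* Uniqueness: a maximal [E] lies in [D], so its own maximality forces [D = E]. *)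
exists D; split=> [|E [RE maxE]]; last by apply: maxE => //; exact: supD.
by split=> // E RE DE; apply/submodCoalg_ext/seteqP; split=> //; exact: supD.
Qed.
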